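(* Let $\mathcal M$ be the mapping class group of $\Sigma=\Sigma_{g,1}$ with its double Johnson filtration $(\mathcal M_{m,n})_{m,n\ge-1}$ and its Johnson filtration $(J_k\mathcal M)_{k\ge1}$. Then $\mathcal M_{m,n}\subset J_{m+n}\mathcal M$ for all integers $m,n\ge-1$ with $m+n\ge1$.
   Context: Let $g\ge0$ be an integer. Let $S^3=V\cup V'$ be the standard Heegaard splitting of genus $g$ ($V,V'$ handlebodies of genus $g$ with $\partial V=\partial V'$). Fix a disk $D\subset\partial V$, and let $\Sigma$ be the compact connected oriented surface of genus $g$ with one boundary component such that $\partial V=\Sigma\cup D$; fix $*\in\partial\Sigma$. Let $K=\pi_1(\Sigma,* )$, which is free of rank $2g$, with free basis $\{x_i,y_i\}_{1\le i\le g}$ given by the standard meridians $x_i$ (bounding disks in $V$) and parallels $y_i$ (bounding disks in $V'$), and let $\bar X=\ker(K\to\pi_1(V,* ))=\langle\langle x_1,\dots,x_g\rangle\rangle_K$ and $\bar Y=\ker(K\to\pi_1(V',* ))=\langle\langle y_1,\dots,y_g\rangle\rangle_K$ (normal closures). $\mathcal M$ is the group of isotopy classes of orientation-preserving homeomorphisms of $\Sigma$ fixing $\partial\Sigma$ pointwise; it acts on $K$. Write $[a,b]=aba^{-1}b^{-1}$, $[h,k]=h(k)k^{-1}$ for $h\in\mathcal M$, $k\in K$, and $[h,S]\subset T$ if $[h,s]\in T$ for all $s\in S$. $\Gamma_n$ denotes the $n$-th term of the lower central series ($\Gamma_1G=G$). Double lower central series of $(K;\bar X,\bar Y)$: $K_{0,0}=K$,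 $K_{m,0}=\Gamma_m\bar X$ and $K_{0,n}=\Gamma_n\bar Y$ for $m,n\ge1$, $K_{m,n}=[K_{1,0},K_{m-1,n}][K_{0,1},K_{m,n-1}]$ for $m,n\ge1$; extended by $K_{m,n}=K_{\max(0,m),\max(0,n)}$ for $(m,n)\in\mathbb Z^2$. Double Johnson filtration of $\mathcal M$: for $m,n\ge-1$, $\mathcal M_{m,n}=\{h\in\mathcal M\mid[h^{\pm1},K_{1,0}]\subset K_{m+1,n}\text{ and }[h^{\pm1},K_{0,1}]\subset K_{m,n+1}\}$. Johnson filtration: $J_k\mathcal M=\{h\in\mathcal M\mid[h,K]\subset\Gamma_{k+1}K\}$ for $k\ge1$. *)

(* Defs.v *)
From HB Require Import structures.
From mathcomp Require Import all_boot all_order all_algebra generic_quotient.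
From mathcomp Require Import all_classical reals topology normedtype trigo.
From mathcomp Require Import ring lra.

Set Implicit Arguments.
Unset Strict Implicit.
Unset Printing Implicit Defensive.

Import Order.TTheory GRing.Theory Num.Theory.
Import numFieldNormedType.Exports.

Local Open Scope classical_set_scope.
Local Open Scope ring_scope.
Local Open Scope quotient_scope.

Definition unitI (R : realType) : set R := `[0, 1].
Arguments unitI {R}.

(* Paths and homotopies are total functions whose values matter only on [unitI];
   composing with [clamp] makes them continuous everywhere. *)
Definition clamp (R : realType) (t : R) : R := Num.max 0 (Num.min 1 t).

Section continuity.
Context {S T U : topologicalType}.

Lemma comp_continuous (f : S -> T) (g : T -> U) :
  continuous f -> continuous g -> continuous (fun s => g (f s)).
Proof. by move=> cf cg s; exact: continuous_comp (cf s) (cg (f s)). Qed.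

Lemma pair_continuous (f : S -> T) (g : S -> U) :
  continuous f -> continuous g -> continuous (fun s => (f s, g s)).
Proof. by move=> cf cg s; apply: cvg_pair; [exact: cf|exact: cg]. Qed.

Lemma fst_continuous : continuous (@fst S T).
Proof. by move=> s; exact: cvg_fst. Qed.

Lemma snd_continuous : continuous (@snd S T).
Proof. by move=> s; exact: cvg_snd. Qed.

Lemma comp_fst_continuous (f : S -> U) :
  continuous f -> continuous (fun p : S * T => f p.1).
Proof.
move=> cf s.
exact: (@continuous_comp _ _ _ fst f s (fst_continuous (x:=s)) (cf _)).
Qed.

Lemma comp_snd_continuous (f : T -> U) :
  continuous f -> continuous (fun p : S * T => f p.2).
Proof.
move=> cf s.
exact: (@continuous_comp _ _ _ snd f s (snd_continuous (x:=s)) (cf _)).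
Qed.

End continuity.

Section continuity_arith.
Context {R : realType} {S : topologicalType}.
Implicit Types f g : S -> R.

Lemma add_continuous f g :
  continuous f -> continuous g -> continuous (fun s => f s + g s).
Proof. by move=> cf cg s; exact: (@cvgD _ R^o _ _ _ f g _ _ (cf s) (cg s)). Qed.

Lemma sub_continuous f g :
  continuous f -> continuous g -> continuous (fun s => f s - g s).
Proof. by move=> cf cg s; exact: (@cvgB _ R^o _ _ _ f g _ _ (cf s) (cg s)). Qed.

Lemma mul_continuous f g :
  continuous f -> continuous g -> continuous (fun s => f s * g s).
Proof. by move=> cf cg s; exact: (cvgM (cf s) (cg s)). Qed.

Lemma cst_cont (c : R) : continuous (fun _ : S => c).
Proof. by move=> s; exact: cvg_cst. Qed.

Lemma min_continuous f g :
  continuous f -> continuous g -> continuous (fun s => Num.min (f s) (g s)).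
Proof. by move=> cf cg s; exact: (@continuous_min R S f g s (cf s) (cg s)). Qed.

Lemma max_continuous f g :
  continuous f -> continuous g -> continuous (fun s => Num.max (f s) (g s)).
Proof. by move=> cf cg s; exact: (@continuous_max R S f g s (cf s) (cg s)). Qed.

End continuity_arith.

Section unit_interval.
Context {R : realType}.
Implicit Types t : R.

Lemma clamp_in t : unitI (clamp t).
Proof.
by rewrite /unitI /clamp /= in_itv /= le_max lexx ge_max ler01 ge_min lexx.
Qed.

Lemma clampE t : unitI t -> clamp t = t.
Proof.
rewrite /unitI /clamp /= in_itv /= => /andP[t0 t1].
by rewrite (min_idPr t1) (max_idPr t0).
Qed.

Lemma continuous_clamp : continuous (@clamp R).
Proof.
apply: max_continuous; first exact: cst_cont.
by apply: min_continuous => [|t]; [exact: cst_cont|exact: cvg_id].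
Qed.

Lemma within_comp (S U T : topologicalType) (A : set U) (f : U -> T)
    (c : S -> U) :
  {within A, continuous f} -> continuous c -> (forall s, A (c s)) ->
  continuous (f \o c).
Proof.
move=> /subspace_continuousP cf cc cA s W hW.
have := cc s _ (cf _ (cA s) W hW); rewrite /= /within /nbhs /=.
by apply: filterS => z /=; apply; exact: cA.
Qed.

Lemma within_eq (U T : topologicalType) (A : set U) (f g : U -> T) :
  (forall u, A u -> f u = g u) -> continuous f -> {within A, continuous g}.
Proof.
move=> fg /(@continuous_subspaceT _ _ A); apply: subspace_eq_continuous => u.
by rewrite inE => /fg.
Qed.

Lemma continuous_glue (S T : topologicalType) (h : S -> R) (c : R)
    (f g : S -> T) : continuous h -> continuous f -> continuous g ->
  (forall s, h s = c -> f s = g s) ->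
  continuous (fun s => if h s <= c then f s else g s).
Proof.
move=> ch cf cg fg; apply/continuous_subspace_setT.
have -> : [set: S] = [set s | h s <= c] `|` [set s | c <= h s].
  by apply/seteqP; split=> // s _ /=; case: (leP (h s) c) => ?; [left|right; exact: ltW].
have cl1 : closed [set s | h s <= c].
  by apply: (@closed_comp _ _ h [set x | x <= c]) => //; exact: closed_le.
have cl2 : closed [set s | c <= h s].
  by apply: (@closed_comp _ _ h [set x | c <= x]) => //; exact: closed_ge.
apply: withinU_continuous => //.
  by apply: within_eq cf => s /= ->.
apply: within_eq cg => s /= cs; case: (leP (h s) c) => // sc.
by rewrite fg //; apply/eqP; rewrite eq_le sc.
Qed.

End unit_interval.

Section loops.
Context {R : realType} {T : topologicalType}.

Record loop (x : T) := Loop {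
  loop_fun :> R -> T;
  loop_continuous : {within unitI, continuous loop_fun};
  loop0 : loop_fun 0 = x;
  loop1 : loop_fun 1 = x }.

HB.instance Definition _ (x : T) := gen_eqMixin (loop x).
HB.instance Definition _ (x : T) := gen_choiceMixin (loop x).

Variable x : T.
Implicit Types a b c : loop x.

Definition homotopic a b := exists H : R * R -> T,
  [/\ {within unitI `*` unitI, continuous H},
      forall t, unitI t -> H (0, t) = a t,
      forall t, unitI t -> H (1, t) = b t &
      forall s, unitI s -> H (s, 0) = x /\ H (s, 1) = x].

Lemma loop_ext a : continuous (a \o @clamp R).
Proof.
apply: within_comp (@loop_continuous _ a) (@continuous_clamp R) _.
exact: clamp_in.
Qed.

Lemma unitI0 : unitI (0 : R).
Proof. by rewrite /unitI /= in_itv /= lexx ler01. Qed.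

Lemma unitI1 : unitI (1 : R).
Proof. by rewrite /unitI /= in_itv /= lexx ler01. Qed.

Lemma homotopicP a b : homotopic a b <-> exists H : R * R -> T,
  [/\ continuous H,
      forall t, H (0, t) = a (clamp t),
      forall t, H (1, t) = b (clamp t) &
      forall s, H (s, 0) = x /\ H (s, 1) = x].
Proof.
split=> [[H [cH H0 H1 Hx]]|[H [cH H0 H1 Hx]]].
  exists (fun p => H (clamp p.1, clamp p.2)); split=> /=.
  - apply: (within_comp cH) => [|p]; last by split; exact: clamp_in.
    apply: pair_continuous.
      exact: comp_fst_continuous (@continuous_clamp R).
    exact: comp_snd_continuous (@continuous_clamp R).
  - by move=> t; rewrite (clampE unitI0) H0 //; exact: clamp_in.
  - by move=> t; rewrite (clampE unitI1) H1 //; exact: clamp_in.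
  - move=> s; rewrite (clampE unitI0) (clampE unitI1); apply: Hx; exact: clamp_in.
exists H; split.
- exact: continuous_subspaceT.
- by move=> t tI; rewrite H0 clampE.
- by move=> t tI; rewrite H1 clampE.
- by move=> s _; exact: Hx.
Qed.

Lemma homotopic_reparam a b c (phi psi : R -> R) :
  continuous phi -> continuous psi -> phi 0 = psi 0 -> phi 1 = psi 1 ->
  (forall t, unitI t -> b t = a (clamp (phi t))) ->
  (forall t, unitI t -> c t = a (clamp (psi t))) ->
  homotopic b c.
Proof.
move=> cphi cpsi e0 e1 bE cE.
exists (fun p => a (clamp (phi p.2 + p.1 * (psi p.2 - phi p.2)))); split => /=.
- apply: continuous_subspaceT.
  apply: (comp_continuous _ (@loop_ext a)).
  apply: add_continuous; first exact: comp_snd_continuous.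
  apply: mul_continuous; first exact: fst_continuous.
  exact: (comp_snd_continuous (sub_continuous cpsi cphi)).
- by move=> t tI; rewrite mul0r addr0 bE.
- by move=> t tI; rewrite mul1r addrC subrK cE.
- move=> s _; rewrite e0 e1 !subrr !mulr0 !addr0 -e0 -e1.
  by rewrite -(bE _ unitI0) -(bE _ unitI1) loop0 loop1.
Qed.

Lemma homotopic_refl a : homotopic a a.
Proof.
apply/homotopicP; exists (fun p => a (clamp p.2)); split=> //= [|s].
  exact: comp_snd_continuous (@loop_ext a).
by rewrite (clampE unitI0) (clampE unitI1) loop0 loop1.
Qed.

Lemma homotopic_sym a b : homotopic a b -> homotopic b a.
Proof.
move=> /homotopicP[H [cH H0 H1 Hx]]; apply/homotopicP.
exists (fun p => H (1 - p.1, p.2)); split=> /= [|t|t|s].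
- apply: (comp_continuous _ cH); apply: pair_continuous.
    by apply: sub_continuous; [exact: cst_cont|exact: fst_continuous].
  exact: snd_continuous.
- by rewrite subr0.
- by rewrite subrr.
- exact: Hx.
Qed.

Lemma half_double : 2 * 2^-1 = 1 :> R. Proof. by field. Qed.

Lemma homotopic_trans a b c :
  homotopic a b -> homotopic b c -> homotopic a c.
Proof.
move=> /homotopicP[H [cH H0 H1 Hx]] /homotopicP[G [cG G0 G1 Gx]].
apply/homotopicP.
exists (fun p => if p.1 <= 2^-1 then H (2 * p.1, p.2) else G (2 * p.1 - 1, p.2)).
split=> /= [|t|t|s].
- apply: continuous_glue => [|||p /= ->].
  + exact: fst_continuous.
  + apply: (comp_continuous _ cH); apply: pair_continuous; last exact: snd_continuous.
    by apply: mul_continuous; [exact: cst_cont|exact: fst_continuous].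
  + apply: (comp_continuous _ cG); apply: pair_continuous; last exact: snd_continuous.
    apply: sub_continuous; last exact: cst_cont.
    by apply: mul_continuous; [exact: cst_cont|exact: fst_continuous].
  + by rewrite half_double subrr H1 G0.
- by rewrite invr_ge0 ler0n mulr0.
- by rewrite ifF; [rewrite (_ : 2 * 1 - 1 = 1) ?G1//; ring|apply/negbTE; lra].
- by case: ifP.
Qed.

Definition homotopicb a b := `[< homotopic a b >].

Lemma homotopicb_refl : reflexive homotopicb.
Proof. by move=> a; apply/asboolP; exact: homotopic_refl. Qed.

Lemma homotopicb_sym : symmetric homotopicb.
Proof. by move=> a b; apply: asbool_equiv_eq; split; exact: homotopic_sym. Qed.

Lemma homotopicb_trans : transitive homotopicb.
Proof.
by move=> b a c /asboolP ab /asboolP bc; apply/asboolP; exact: homotopic_trans bc.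
Qed.

Canonical homotopic_equiv :=
  EquivRel homotopicb homotopicb_refl homotopicb_sym homotopicb_trans.

Definition pi1 := {eq_quot homotopicb}.

HB.instance Definition _ := Choice.on pi1.
HB.instance Definition _ := EqQuotient.on pi1.

Definition cls (a : loop x) : pi1 := \pi_pi1 a.

Lemma clsP a b : cls a = cls b <-> homotopic a b.
Proof.
split=> [/eqP|ab]; first by rewrite eqmodE => /asboolP.
by apply/eqP; rewrite eqmodE; apply/asboolP.
Qed.

Lemma cls_repr (k : pi1) : cls (repr k) = k.
Proof. exact: reprK. Qed.

Lemma in_unitI (t : R) : unitI t = (0 <= t <= 1) :> Prop.
Proof. by rewrite /unitI /= in_itv. Qed.

Lemma clamp_le0 (t : R) : t <= 0 -> clamp t = 0.
Proof. by move=> t0; rewrite /clamp; apply/max_idPl; rewrite ge_min t0 orbT. Qed.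

Lemma clamp_ge1 (t : R) : 1 <= t -> clamp t = 1.
Proof. by move=> t1; rewrite /clamp (min_idPl t1); apply/max_idPr; exact: ler01. Qed.

Definition loop_mul_fun a b (t : R) : T :=
  if t <= 2^-1 then a (2 * t) else b (2 * t - 1).

Lemma loop_mul_funE a b (t : R) : unitI t -> loop_mul_fun a b t =
  if t <= 2^-1 then a (clamp (2 * t)) else b (clamp (2 * t - 1)).
Proof.
rewrite in_unitI => tI; rewrite /loop_mul_fun; case: ifPn => th.
  by rewrite clampE // in_unitI; lra.
by rewrite clampE // in_unitI; lra.
Qed.

Lemma double_continuous : continuous (fun t : R => 2 * t).
Proof. by apply: mul_continuous => [|t]; [exact: cst_cont|exact: cvg_id]. Qed.

Lemma double1_continuous : continuous (fun t : R => 2 * t - 1).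
Proof. by apply: sub_continuous double_continuous _; exact: cst_cont. Qed.

Lemma loop_mul_continuous a b : {within unitI, continuous (loop_mul_fun a b)}.
Proof.
apply: (@within_eq R _ unitI (fun t => if t <= 2^-1 then a (clamp (2 * t))
                                   else b (clamp (2 * t - 1)))).
  by move=> t /(loop_mul_funE a b) ->.
apply: (@continuous_glue R R T id) => [t|||t ->]; first exact: cvg_id.
- exact: comp_continuous double_continuous (@loop_ext a).
- exact: comp_continuous double1_continuous (@loop_ext b).
- by rewrite half_double subrr (clampE unitI0) (clampE unitI1) loop1 loop0.
Qed.

Lemma loop_mul0 a b : loop_mul_fun a b 0 = x.
Proof. by rewrite /loop_mul_fun invr_ge0 ler0n mulr0 loop0. Qed.

Lemma loop_mul1 a b : loop_mul_fun a b 1 = x.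
Proof.
rewrite /loop_mul_fun ifF; last by apply/negbTE; lra.
by rewrite (_ : 2 * 1 - 1 = 1) ?loop1 //; ring.
Qed.

Definition loop_mul a b : loop x :=
  Loop (@loop_mul_continuous a b) (loop_mul0 a b) (loop_mul1 a b).

Lemma loop_one_continuous : {within unitI, continuous (fun _ : R => x)}.
Proof. by apply: continuous_subspaceT => t; exact: cvg_cst. Qed.

Definition loop_one : loop x := Loop loop_one_continuous erefl erefl.

Lemma opp_continuous1 : continuous (fun t : R => 1 - t).
Proof. by apply: sub_continuous => [|t]; [exact: cst_cont|exact: cvg_id]. Qed.

Lemma loop_inv_continuous a : {within unitI, continuous (fun t : R => a (1 - t))}.
Proof.
apply: (@within_eq R _ unitI (fun t => a (clamp (1 - t)))).
  by move=> t; rewrite in_unitI => tI; rewrite clampE // in_unitI; lra.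
exact: comp_continuous opp_continuous1 (@loop_ext a).
Qed.

Lemma loop_inv0 a : a (1 - 0) = x. Proof. by rewrite subr0 loop1. Qed.
Lemma loop_inv1 a : a (1 - 1) = x. Proof. by rewrite subrr loop0. Qed.

Definition loop_inv a : loop x :=
  Loop (@loop_inv_continuous a) (loop_inv0 a) (loop_inv1 a).

Lemma loop_mul_homotopic a a' b b' :
  homotopic a a' -> homotopic b b' -> homotopic (loop_mul a b) (loop_mul a' b').
Proof.
move=> /homotopicP[H [cH H0 H1 Hx]] /homotopicP[G [cG G0 G1 Gx]].
exists (fun p => if p.2 <= 2^-1 then H (p.1, 2 * p.2) else G (p.1, 2 * p.2 - 1)).
split=> /= [|t tI|t tI|s _].
- apply: continuous_subspaceT; apply: continuous_glue => [|||p /= ->].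
  + exact: snd_continuous.
  + apply: (comp_continuous _ cH); apply: pair_continuous.
      exact: fst_continuous.
    exact: (comp_snd_continuous double_continuous).
  + apply: (comp_continuous _ cG); apply: pair_continuous.
      exact: fst_continuous.
    exact: (comp_snd_continuous double1_continuous).
  + by rewrite half_double subrr (Hx _).2 (Gx _).1.
- by rewrite loop_mul_funE // H0 G0.
- by rewrite loop_mul_funE // H1 G1.
- rewrite invr_ge0 ler0n mulr0 (Hx s).1; split=> //.
  rewrite ifF; last by apply/negbTE; lra.
  by rewrite (_ : 2 * 1 - 1 = 1) ?(Gx s).2 //; ring.
Qed.

Lemma loop_inv_homotopic a b :
  homotopic a b -> homotopic (loop_inv a) (loop_inv b).
Proof.
move=> /homotopicP[H [cH H0 H1 Hx]].
exists (fun p => H (p.1, 1 - p.2)); split=> /= [|t|t|s _].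
- apply: continuous_subspaceT; apply: (comp_continuous _ cH).
  apply: pair_continuous; first exact: fst_continuous.
  exact: (comp_snd_continuous opp_continuous1).
- by rewrite in_unitI => tI; rewrite H0 clampE // in_unitI; lra.
- by rewrite in_unitI => tI; rewrite H1 clampE // in_unitI; lra.
- by rewrite subr0 subrr (Hx s).1 (Hx s).2.
Qed.

Lemma loop_mulA a b c :
  homotopic (loop_mul a (loop_mul b c)) (loop_mul (loop_mul a b) c).
Proof.
pose phi (t : R) : R := Num.min (2 * t) (Num.min (t + 4^-1) (2^-1 * t + 2^-1)).
have phiE t : phi t = if t <= 4^-1 then 2 * t
                       else if t <= 2^-1 then t + 4^-1 else 2^-1 * t + 2^-1.
  rewrite /phi; case: (leP (t + 4^-1) (2^-1 * t + 2^-1)) => ?;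
    case: (leP (2 * t)) => ?;
    case: (leP t (4^-1)) => ?; case: (leP t (2^-1)) => ?; lra.
have cid : continuous (fun t : R => t) by move=> t; exact: cvg_id.
apply: homotopic_sym.
apply: (@homotopic_reparam (loop_mul a (loop_mul b c)) _ _ phi (fun t => t)) => //.
- apply: min_continuous double_continuous _; apply: min_continuous.
    by apply: add_continuous; [exact: cid|exact: cst_cont].
  apply: add_continuous; last exact: cst_cont.
  by apply: mul_continuous; [exact: cst_cont|exact: cid].
- by rewrite phiE ifT //; lra.
- by rewrite phiE !ifF //; [lra|apply/negbTE; lra|apply/negbTE; lra].
- move=> t; rewrite in_unitI => tI.
  have [t4|t4] := leP t (4^-1).
    have -> : phi t = 2 * t by rewrite phiE t4.
    rewrite clampE ?in_unitI; last lra.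
    rewrite /= /loop_mul_fun ifT; last lra.
    rewrite /= /loop_mul_fun ifT; last lra.
    by rewrite ifT //; lra.
  have [t2|t2] := leP t (2^-1).
    have -> : phi t = t + 4^-1 by rewrite phiE leNgt t4 /= t2.
    rewrite clampE ?in_unitI; last lra.
    rewrite /= /loop_mul_fun ifT //= /loop_mul_fun ifF; last by apply/negbTE; lra.
    rewrite ifF; last by apply/negbTE; lra.
    rewrite /= /loop_mul_fun ifT; last lra.
    by congr (b _); lra.
  have -> : phi t = 2^-1 * t + 2^-1 by rewrite phiE !leNgt t4 t2.
  rewrite clampE ?in_unitI; last lra.
  rewrite /= /loop_mul_fun ifF; last by apply/negbTE; lra.
  rewrite ifF; last by apply/negbTE; lra.
  rewrite /= /loop_mul_fun ifF; last by apply/negbTE; lra.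
  by congr (c _); lra.
- by move=> t tI; rewrite clampE.
Qed.

Lemma loop_mul1l a : homotopic (loop_mul loop_one a) a.
Proof.
apply: (@homotopic_reparam a _ _ (fun t => clamp (2 * t - 1)) (fun t => t)).
- exact: comp_continuous double1_continuous (@continuous_clamp R).
- by move=> t; exact: cvg_id.
- by rewrite clamp_le0 //; lra.
- by rewrite clamp_ge1 //; lra.
- move=> t tI; rewrite /= loop_mul_funE //; case: ifPn => th.
    by rewrite (@clamp_le0 (2 * t - 1)) ?(clampE unitI0) ?loop0 //; lra.
  by rewrite (clampE (clamp_in _)).
- by move=> t tI; rewrite clampE.
Qed.

Lemma loop_mul1r a : homotopic (loop_mul a loop_one) a.
Proof.
apply: (@homotopic_reparam a _ _ (fun t => clamp (2 * t)) (fun t => t)).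
- exact: comp_continuous double_continuous (@continuous_clamp R).
- by move=> t; exact: cvg_id.
- by rewrite clamp_le0 //; lra.
- by rewrite clamp_ge1 //; lra.
- move=> t tI; rewrite /= loop_mul_funE //; case: ifPn => th.
    by rewrite (clampE (clamp_in _)).
  by rewrite (@clamp_ge1 (2 * t)) ?(clampE unitI1) ?loop1 //; lra.
- by move=> t tI; rewrite clampE.
Qed.

Lemma absdouble_continuous : continuous (fun t : R => `|2 * t - 1|).
Proof.
apply: comp_continuous double1_continuous _ => t; exact: (@norm_continuous R R^o).
Qed.

Lemma loop_mulVl a : homotopic (loop_mul (loop_inv a) a) loop_one.
Proof.
apply: (@homotopic_reparam a _ _ (fun t => `|2 * t - 1|) (fun=> 1)).
- exact: absdouble_continuous.
- exact: cst_cont.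
- by rewrite mulr0 sub0r normrN1.
- by rewrite ger0_norm; lra.
- move=> t; rewrite in_unitI => tI; rewrite /= /loop_mul_fun; case: ifPn => th.
    rewrite /= ler0_norm; last lra.
    by rewrite clampE ?in_unitI; [congr (a _); lra|lra].
  by rewrite ger0_norm; [rewrite clampE ?in_unitI //; lra|lra].
- by move=> t tI /=; rewrite (clampE unitI1) loop1.
Qed.

Lemma loop_mulVr a : homotopic (loop_mul a (loop_inv a)) loop_one.
Proof.
apply: (@homotopic_reparam a _ _ (fun t => 1 - `|2 * t - 1|) (fun=> 0)).
- exact: comp_continuous absdouble_continuous opp_continuous1.
- exact: cst_cont.
- by rewrite mulr0 sub0r normrN1 subrr.
- by rewrite ger0_norm; lra.
- move=> t; rewrite in_unitI => tI; rewrite /= /loop_mul_fun; case: ifPn => th.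
    rewrite /= ler0_norm; last lra.
    by rewrite clampE ?in_unitI; [congr (a _); lra|lra].
  by rewrite ger0_norm; [rewrite clampE ?in_unitI //=; lra|lra].
- by move=> t tI /=; rewrite (clampE unitI0) loop0.
Qed.

Definition pi1_mul (k l : pi1) : pi1 := cls (loop_mul (repr k) (repr l)).
Definition pi1_inv (k : pi1) : pi1 := cls (loop_inv (repr k)).
Definition pi1_one : pi1 := cls loop_one.

Lemma repr_cls a : homotopic (repr (cls a)) a.
Proof. by apply/clsP; rewrite cls_repr. Qed.

Lemma pi1_mulE a b : pi1_mul (cls a) (cls b) = cls (loop_mul a b).
Proof. by apply/clsP; apply: loop_mul_homotopic; exact: repr_cls. Qed.

Lemma pi1_invE a : pi1_inv (cls a) = cls (loop_inv a).
Proof. by apply/clsP; apply: loop_inv_homotopic; exact: repr_cls. Qed.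

Lemma pi1_mulA : associative pi1_mul.
Proof.
move=> k l m; rewrite -(cls_repr k) -(cls_repr l) -(cls_repr m) !pi1_mulE.
by apply/clsP; exact: loop_mulA.
Qed.

Lemma pi1_mul1g : left_id pi1_one pi1_mul.
Proof. by move=> k; rewrite -(cls_repr k) pi1_mulE; apply/clsP; exact: loop_mul1l. Qed.

Lemma pi1_mulg1 : right_id pi1_one pi1_mul.
Proof. by move=> k; rewrite -(cls_repr k) pi1_mulE; apply/clsP; exact: loop_mul1r. Qed.

Lemma pi1_mulVg : left_inverse pi1_one pi1_inv pi1_mul.
Proof.
by move=> k; rewrite -(cls_repr k) pi1_invE pi1_mulE; apply/clsP; exact: loop_mulVl.
Qed.

Lemma pi1_mulgV : right_inverse pi1_one pi1_inv pi1_mul.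
Proof.
by move=> k; rewrite -(cls_repr k) pi1_invE pi1_mulE; apply/clsP; exact: loop_mulVr.
Qed.

HB.instance Definition _ :=
  isGroup.Build pi1 pi1_mulA pi1_mul1g pi1_mulg1 pi1_mulVg pi1_mulgV.

Lemma clsM a b : (cls a * cls b)%g = cls (loop_mul a b).
Proof. exact: pi1_mulE. Qed.

End loops.

Arguments loop R {T} x.
Arguments pi1 R {T} x.

Section induced_map.
Context {R : realType} {T U : topologicalType} (f : T -> U) (x : T) (y : U).
Hypotheses (cf : continuous f) (fx : f x = y).

Lemma loop_map_continuous (a : loop R x) :
  {within unitI, continuous (fun t => f (a t))}.
Proof.
apply: (@within_eq R _ unitI (fun t => f (a (clamp t)))).
  by move=> t tI; rewrite clampE.
exact: comp_continuous (@loop_ext _ _ _ a) cf.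
Qed.

Lemma loop_map0 (a : loop R x) : f (a 0) = y.
Proof. by rewrite loop0. Qed.

Lemma loop_map1 (a : loop R x) : f (a 1) = y.
Proof. by rewrite loop1. Qed.

Definition loop_map (a : loop R x) : loop R y :=
  Loop (@loop_map_continuous a) (loop_map0 a) (loop_map1 a).

Definition pi1_map (k : pi1 R x) : pi1 R y := cls (loop_map (repr k)).

Lemma loop_map_homotopic (a b : loop R x) :
  homotopic a b -> homotopic (loop_map a) (loop_map b).
Proof.
move=> /homotopicP[H [cH H0 H1 Hx]]; exists (fun p => f (H p)); split=> /=.
- by apply: continuous_subspaceT; exact: comp_continuous cH cf.
- by move=> t tI; rewrite H0 clampE.
- by move=> t tI; rewrite H1 clampE.
- by move=> s _; rewrite (Hx s).1 (Hx s).2.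
Qed.

Lemma pi1_map_cls (a : loop R x) : pi1_map (cls a) = cls (loop_map a).
Proof. by apply/clsP; apply: loop_map_homotopic; exact: repr_cls. Qed.

Lemma loop_eq (z : U) (a b : loop R z) : a =1 b -> homotopic a b.
Proof.
move=> ab; have [H [cH H0 H1 Hx]] := homotopic_refl a.
by exists H; split=> // t tI; rewrite H1.
Qed.

Lemma pi1_mapM (k l : pi1 R x) : pi1_map (k * l)%g = (pi1_map k * pi1_map l)%g.
Proof.
rewrite -(cls_repr k) -(cls_repr l) clsM !pi1_map_cls clsM.
by apply/clsP; apply: loop_eq => t /=; rewrite /loop_mul_fun /=; case: ifP.
Qed.

End induced_map.

Section orientation.
Context {R : realType} {T : topologicalType}.
Implicit Types c : R * R -> T.

Definition planar_chart c :=
  [/\ continuous c, injective c & forall U, open U -> open (c @` U)].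

Definition circle (t : R) : R * R := (cos (2 * pi * t), sin (2 * pi * t)).

(* [c'^-1 \o c] preserves the orientation of the plane wherever it is defined:
   it maps every small positive circle around [u] to a loop that is freely
   homotopic, in the plane minus the image [v] of [u], to the positive circle
   around [v]. *)
Definition positive_transition c c' := forall u v : R * R, c u = c' v ->
  \forall r \near 0^'+, exists H : R * R -> R * R,
    [/\ {within unitI `*` unitI, continuous H},
        forall p, (unitI `*` unitI) p -> H p != v,
        forall t, unitI t -> c' (H (0, t)) = c (u + r *: circle t),
        forall t, unitI t -> H (1, t) = v + circle t &
        forall s, unitI s -> H (s, 0) = H (s, 1)].

(* An orientation of a surface with boundary [B] is a maximal oriented atlas of
   its interior. *)
Definition orientation (B : set T) (O : set (R * R -> T)) :=
  [/\ O `<=` planar_chart,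
      forall z, ~ B z <-> exists2 c, O c & range c z,
      forall c c', O c -> O c' -> positive_transition c c' &
      forall c, planar_chart c ->
        (forall c', O c' -> positive_transition c c' /\ positive_transition c' c) ->
        O c].

End orientation.

Section mapping_class_group.
Context {R : realType} {T : topologicalType}.
Variables (B : set T) (O : set (R * R -> T)).

Record homeo := Homeo {
  homeo_fun :> T -> T;
  homeo_inv_fun : T -> T;
  homeoK : cancel homeo_fun homeo_inv_fun;
  homeoVK : cancel homeo_inv_fun homeo_fun;
  homeo_continuous : continuous homeo_fun;
  homeo_inv_continuous : continuous homeo_inv_fun;
  homeo_fix : forall z, B z -> homeo_fun z = z;
  homeo_orient : forall c, O (homeo_fun \o c) <-> O c }.

HB.instance Definition _ := gen_eqMixin homeo.
HB.instance Definition _ := gen_choiceMixin homeo.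

Implicit Types f g h : homeo.

(* The isotopies move through homeomorphisms that fix [B] pointwise. *)
Definition isotopic f g := exists H : R -> homeo,
  [/\ {within unitI `*` setT, continuous (fun p : R * T => H p.1 p.2)},
      H 0 =1 f & H 1 =1 g].

Lemma isotopicP f g : isotopic f g <-> exists H : R -> homeo,
  [/\ continuous (fun p : R * T => H p.1 p.2), H 0 =1 f & H 1 =1 g].
Proof.
split=> -[H [cH H0 H1]]; last first.
  by exists H; split=> //; exact: continuous_subspaceT.
exists (H \o @clamp R); split=> [|z|z] /=; last 2 first.
- by rewrite (clampE unitI0).
- by rewrite (clampE unitI1).
apply: (@within_comp (R * T)%type _ _ _ _
  (fun p : R * T => (clamp p.1, p.2)) cH) => [|p].
  apply: pair_continuous; last exact: snd_continuous.
  exact: comp_fst_continuous (@continuous_clamp R).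
by split=> //; exact: clamp_in.
Qed.

Lemma eq_isotopic f g : f =1 g -> isotopic f g.
Proof.
move=> fg; apply/isotopicP; exists (fun=> f); split=> //.
exact: comp_snd_continuous (@homeo_continuous f).
Qed.

Lemma isotopic_refl f : isotopic f f.
Proof. exact: eq_isotopic. Qed.

Lemma isotopic_sym f g : isotopic f g -> isotopic g f.
Proof.
move=> /isotopicP[H [cH H0 H1]]; apply/isotopicP.
exists (fun s => H (1 - s)); split=> [|z|z]; last 2 first.
- by rewrite subr0.
- by rewrite subrr.
apply: (comp_continuous (f := fun p : R * T => (1 - p.1, p.2)) _ cH).
apply: pair_continuous; last exact: snd_continuous.
exact: (comp_fst_continuous opp_continuous1).
Qed.

Lemma isotopic_trans f g h : isotopic f g -> isotopic g h -> isotopic f h.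
Proof.
move=> /isotopicP[H [cH H0 H1]] /isotopicP[G [cG G0 G1]]; apply/isotopicP.
exists (fun s => if s <= 2^-1 then H (2 * s) else G (2 * s - 1)).
split=> [|z|z]; last 2 first.
- by rewrite invr_ge0 ler0n mulr0 H0.
- rewrite ifF; last by apply/negbTE; lra.
  by rewrite (_ : 2 * 1 - 1 = 1) ?G1 //; ring.
rewrite (_ : (fun p : R * T => _) = fun p : R * T => if p.1 <= 2^-1
    then H (2 * p.1) p.2 else G (2 * p.1 - 1) p.2); last first.
  by apply/funext => p; case: ifP.
apply: continuous_glue => [|||p ->].
- exact: fst_continuous.
- apply: (comp_continuous (f := fun p : R * T => (2 * p.1, p.2)) _ cH).
  apply: pair_continuous; last exact: snd_continuous.
  exact: (comp_fst_continuous double_continuous).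
- apply: (comp_continuous (f := fun p : R * T => (2 * p.1 - 1, p.2)) _ cG).
  apply: pair_continuous; last exact: snd_continuous.
  exact: (comp_fst_continuous double1_continuous).
- by rewrite half_double subrr H1 G0.
Qed.

Definition isotopicb f g := `[< isotopic f g >].

Lemma isotopicb_refl : reflexive isotopicb.
Proof. by move=> f; apply/asboolP; exact: isotopic_refl. Qed.

Lemma isotopicb_sym : symmetric isotopicb.
Proof. by move=> f g; apply: asbool_equiv_eq; split; exact: isotopic_sym. Qed.

Lemma isotopicb_trans : transitive isotopicb.
Proof.
by move=> g f h /asboolP fg /asboolP gh; apply/asboolP; exact: isotopic_trans gh.
Qed.

Canonical isotopic_equiv :=
  EquivRel isotopicb isotopicb_refl isotopicb_sym isotopicb_trans.

Definition mcg := {eq_quot isotopicb}.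

HB.instance Definition _ := Choice.on mcg.
HB.instance Definition _ := EqQuotient.on mcg.

Definition mclass f : mcg := \pi_mcg f.

Lemma mclassP f g : mclass f = mclass g <-> isotopic f g.
Proof.
split=> [/eqP|fg]; first by rewrite eqmodE => /asboolP.
by apply/eqP; rewrite eqmodE; apply/asboolP.
Qed.

Lemma mclass_repr (h : mcg) : mclass (repr h) = h.
Proof. exact: reprK. Qed.

Lemma repr_mclass f : isotopic (repr (mclass f)) f.
Proof. by apply/mclassP; rewrite mclass_repr. Qed.

Program Definition homeo_one : homeo :=
  @Homeo (fun z => z) (fun z => z) _ _ _ _ _ _.
Next Obligation. by []. Qed.
Next Obligation. by []. Qed.
Next Obligation. by move=> z; exact: cvg_id. Qed.
Next Obligation. by move=> z; exact: cvg_id. Qed.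
Next Obligation. by []. Qed.
Next Obligation. by []. Qed.

Program Definition homeo_mul f g : homeo :=
  @Homeo (fun z => f (g z))
    (fun z => homeo_inv_fun g (homeo_inv_fun f z)) _ _ _ _ _ _.
Next Obligation. by move=> f g z; rewrite !homeoK. Qed.
Next Obligation. by move=> f g z; rewrite !homeoVK. Qed.
Next Obligation.
by move=> f g; apply: comp_continuous; exact: homeo_continuous.
Qed.
Next Obligation.
by move=> f g; apply: comp_continuous; exact: homeo_inv_continuous.
Qed.
Next Obligation. by move=> f g z Bz /=; rewrite (homeo_fix g) // homeo_fix. Qed.
Next Obligation.
move=> f g c.
exact: iff_trans (homeo_orient f (g \o c)) (homeo_orient g c).
Qed.

Program Definition homeo_inv f : homeo :=
  @Homeo (homeo_inv_fun f) f _ _ _ _ _ _.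
Next Obligation. by move=> f; exact: homeoVK. Qed.
Next Obligation. by move=> f; exact: homeoK. Qed.
Next Obligation. by move=> f; exact: homeo_inv_continuous. Qed.
Next Obligation. by move=> f; exact: homeo_continuous. Qed.
Next Obligation. by move=> f z Bz /=; rewrite -{1}(homeo_fix f Bz) homeoK. Qed.
Next Obligation.
move=> f c; apply: iff_sym.
rewrite {1}(_ : c = f \o (homeo_inv_fun f \o c)); first exact: homeo_orient.
by apply/funext => z /=; rewrite homeoVK.
Qed.

Lemma homeo_mul_isotopic f f' g g' :
  isotopic f f' -> isotopic g g' -> isotopic (homeo_mul f g) (homeo_mul f' g').
Proof.
move=> /isotopicP[H [cH H0 H1]] /isotopicP[G [cG G0 G1]]; apply/isotopicP.
exists (fun s => homeo_mul (H s) (G s)); split=> [|z|z] /=; last 2 first.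
- by rewrite H0 G0.
- by rewrite H1 G1.
apply: (comp_continuous (f := fun p : R * T => (p.1, G p.1 p.2)) _ cH).
by apply: pair_continuous => //; exact: fst_continuous.
Qed.

Lemma homeo_inv_isotopic f g :
  isotopic f g -> isotopic (homeo_inv f) (homeo_inv g).
Proof.
move=> fg; apply: isotopic_sym.
pose f' := homeo_inv f; pose g' := homeo_inv g.
apply: (@isotopic_trans _ (homeo_mul (homeo_mul f' f) g')).
  by apply: eq_isotopic => z /=; rewrite homeoK.
apply: (@isotopic_trans _ (homeo_mul (homeo_mul f' g) g')).
  apply: homeo_mul_isotopic (isotopic_refl _).
  exact: homeo_mul_isotopic (isotopic_refl _) fg.
by apply: eq_isotopic => z /=; rewrite homeoVK.
Qed.

Definition mcg_mul (h k : mcg) : mcg := mclass (homeo_mul (repr h) (repr k)).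
Definition mcg_inv (h : mcg) : mcg := mclass (homeo_inv (repr h)).
Definition mcg_one : mcg := mclass homeo_one.

Lemma mcg_mulE f g : mcg_mul (mclass f) (mclass g) = mclass (homeo_mul f g).
Proof. by apply/mclassP; apply: homeo_mul_isotopic; exact: repr_mclass. Qed.

Lemma mcg_invE f : mcg_inv (mclass f) = mclass (homeo_inv f).
Proof. by apply/mclassP; apply: homeo_inv_isotopic; exact: repr_mclass. Qed.

Lemma mcg_mulA : associative mcg_mul.
Proof.
move=> h k l; rewrite -(mclass_repr h) -(mclass_repr k) -(mclass_repr l).
by rewrite !mcg_mulE; apply/mclassP; exact: eq_isotopic.
Qed.

Lemma mcg_mul1g : left_id mcg_one mcg_mul.
Proof.
by move=> h; rewrite -(mclass_repr h) mcg_mulE; apply/mclassP; exact: eq_isotopic.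
Qed.

Lemma mcg_mulg1 : right_id mcg_one mcg_mul.
Proof.
by move=> h; rewrite -(mclass_repr h) mcg_mulE; apply/mclassP; exact: eq_isotopic.
Qed.

Lemma mcg_mulVg : left_inverse mcg_one mcg_inv mcg_mul.
Proof.
move=> h; rewrite -(mclass_repr h) mcg_invE mcg_mulE; apply/mclassP.
by apply: eq_isotopic => z /=; rewrite homeoK.
Qed.

Lemma mcg_mulgV : right_inverse mcg_one mcg_inv mcg_mul.
Proof.
move=> h; rewrite -(mclass_repr h) mcg_invE mcg_mulE; apply/mclassP.
by apply: eq_isotopic => z /=; rewrite homeoVK.
Qed.

HB.instance Definition _ :=
  isGroup.Build mcg mcg_mulA mcg_mul1g mcg_mulg1 mcg_mulVg mcg_mulgV.

Section action.
Variables (p : T) (Bp : B p).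

Definition mcg_act (h : mcg) (k : pi1 R p) : pi1 R p :=
  pi1_map (@homeo_continuous (repr h)) (homeo_fix (repr h) Bp) k.

Lemma mcg_act_mclass f k :
  mcg_act (mclass f) k = pi1_map (@homeo_continuous f) (homeo_fix f Bp) k.
Proof.
rewrite /mcg_act -(cls_repr k) !pi1_map_cls; apply/clsP.
have /isotopicP[H [cH H0 H1]] := repr_mclass f.
exists (fun q => H q.1 (repr k (clamp q.2))); split=> /= [|t tI|t tI|s _].
- apply: continuous_subspaceT.
  apply: (comp_continuous (f := fun q : R * R => (q.1, repr k (clamp q.2))) _ cH).
  apply: pair_continuous; first exact: fst_continuous.
  exact: (comp_snd_continuous (@loop_ext _ _ _ (repr k))).
- by rewrite H0 clampE.
- by rewrite H1 clampE.
- rewrite (clampE unitI0) (clampE unitI1) loop0 loop1.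
  by split; exact: homeo_fix.
Qed.

Lemma mcg_act1 k : mcg_act 1%g k = k.
Proof.
rewrite [1%g]/(mclass homeo_one) mcg_act_mclass -{2}(cls_repr k).
by apply/clsP; exact: loop_eq.
Qed.

Lemma mcg_actM (h h' : mcg) k : mcg_act (h * h')%g k = mcg_act h (mcg_act h' k).
Proof.
rewrite -(mclass_repr h) -(mclass_repr h').
rewrite [(_ * _)%g]mcg_mulE !mcg_act_mclass -(cls_repr k) !pi1_map_cls.
by apply/clsP; exact: loop_eq.
Qed.

Lemma mcg_act_morph (h : mcg) : {morph mcg_act h : k l / (k * l)%g}.
Proof. by move=> k l; exact: pi1_mapM. Qed.

End action.
End mapping_class_group.

Section filtrations.
Local Open Scope group_scope.
Context {G : groupType}.
Implicit Types (S A B X Y H : set G) (a b k : G).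

Definition subgroup H := H 1 /\ forall a b, H a -> H b -> H (a / b).

Definition normal_subgroup H :=
  subgroup H /\ forall k a, H a -> H (k * a * k^-1).

Definition gen S : set G := smallest subgroup S.

Definition normal_closure S : set G := smallest normal_subgroup S.

(* The library's [~ a, b] is a^-1 * b^-1 * a * b. *)
Definition comm a b := a * b * a^-1 * b^-1.

Definition comm_subgroup A B := gen [set comm a b | a in A & b in B].

Definition set_mul A B : set G := [set a * b | a in A & b in B].

(* [lcs H n] is Gamma_n H, for n >= 1 *)
Definition lcs H (n : nat) : set G := iter n.-1 (comm_subgroup H) H.

Definition word_val (I : Type) (b : I -> G) (w : seq (I * bool)) : G :=
  \prod_(l <- w) (if l.2 then b l.1 else (b l.1)^-1).

Definition reduced (I : eqType) (w : seq (I * bool)) : bool :=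
  sorted (fun l l' => (l.1 != l'.1) || (l.2 == l'.2)) w.

Definition free_basis (I : eqType) (b : I -> G) :=
  forall k, exists! w : seq (I * bool), reduced w /\ word_val b w = k.

Fixpoint double_lcs_nat X Y (m : nat) : nat -> set G :=
  match m with
  | 0 => fun n => if n is 0 then setT else lcs Y n
  | m'.+1 => fix row (n : nat) : set G :=
      match n with
      | 0 => lcs X m
      | n'.+1 => set_mul (comm_subgroup X (double_lcs_nat X Y m' n))
                         (comm_subgroup Y (row n'))
      end
  end.

Definition double_lcs X Y (m n : int) : set G :=
  double_lcs_nat X Y `|Num.max 0%R m|%N `|Num.max 0%R n|%N.

Section johnson.
Context {M : groupType} (act : M -> G -> G).

Definition act_comm (h : M) (k : G) := act h k * k^-1.

Definition act_comm_sub (h : M) (S A : set G) := forall s, S s -> A (act_comm h s).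

Definition double_johnson X Y (m n : int) : set M :=
  [set h | forall h', h' = h \/ h' = h^-1 ->
    act_comm_sub h' (double_lcs X Y 1 0) (double_lcs X Y (m + 1) n) /\
    act_comm_sub h' (double_lcs X Y 0 1) (double_lcs X Y m (n + 1))].

Definition johnson (k : nat) : set M :=
  [set h | act_comm_sub h setT (lcs setT k.+1)].

End johnson.
End filtrations.

Section heegaard.
Variable R : realType.

Definition S3 := one_point_compactification (R * R * R)%type.

(* The product of [0, 1] with the rectangle [0, 2g + 1] x [0, 3] minus g open
   squares: an unknotted handlebody of genus g, so that the closure of its
   complement in S^3 is a handlebody of genus g too. *)
Definition handlebody3 (g : nat) : set (R * R * R) :=
  [set p | [/\ 0 <= p.1.1 <= 2 * g%:R + 1, 0 <= p.1.2 <= 3, 0 <= p.2 <= 1 &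
     forall i : nat, (i < g)%N ->
       ~~ ((2 * i%:R + 1 < p.1.1 < 2 * i%:R + 2) && (1 < p.1.2 < 2))]].

Definition handlebody (g : nat) : set S3 := Some @` handlebody3 g.

Definition handlebody' (g : nat) : set S3 := closure (~` handlebody g).

Definition heegaard_surface (g : nat) : set S3 := handlebody g `&` handlebody' g.

Definition embedded_disk (A : set S3) (e : R * R -> S3) :=
  let disk := [set u : R * R | u.1 ^+ 2 + u.2 ^+ 2 <= 1] in
  [/\ {within disk, continuous e}, {in disk &, injective e} & e @` disk `<=` A].

(* The disk removed from the Heegaard surface is [e] of the closed unit disk;
   its interior is [e] of the open one, and its boundary [e] of the circle. *)
Definition surface (g : nat) (e : R * R -> S3) : set S3 :=
  heegaard_surface g `\` e @` [set u | u.1 ^+ 2 + u.2 ^+ 2 < 1].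

Definition surface_boundary (g : nat) (e : R * R -> S3) : set (surface g e) :=
  set_val @^-1` (e @` [set u | u.1 ^+ 2 + u.2 ^+ 2 = 1]).

Lemma surface_sub (g : nat) e : surface g e `<=` handlebody g.
Proof. by move=> z [[]]. Qed.

Lemma surface_sub' (g : nat) e : surface g e `<=` handlebody' g.
Proof. by move=> z [[]]. Qed.

End heegaard.

Arguments surface_boundary {R} g e.
Arguments surface_sub {R} g e.
Arguments surface_sub' {R} g e.

Section inclusion.
Context {R : realType} {T : topologicalType} (A B : set T) (AB : A `<=` B).

Definition inclusion (a : A) : B := exist _ (\val a) (mem_set (AB (set_valP a))).

Lemma inclusion_continuous : continuous inclusion.
Proof.
move=> a W [_ [[V oV <-] Va VW]]; exists (set_val @^-1` V); split=> //.
  by exists V.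
by move=> z Vz; exact: VW.
Qed.

Definition inclusion_kernel (p : A) : set (pi1 R p) :=
  [set k | pi1_map inclusion_continuous (erefl (inclusion p)) k = 1%g].

End inclusion.

Arguments inclusion_kernel R {T A B} AB p.

(* Main.v *)
Require Import Defs.
From mathcomp Require Import all_boot all_order all_algebra.
From mathcomp Require Import all_classical reals topology normedtype.
From mathcomp Require Import zify.

Import numFieldNormedType.Exports.

Local Open Scope classical_set_scope.
Local Open Scope ring_scope.

(* By induction K_{m,n} is contained in Gamma_{m+n} K, so an element h of
   M_{m,n} satisfies [h, Xbar] <= Gamma_{m+n+1} K and [h, Ybar] <=
   Gamma_{m+n+1} K; replacing a negative index by 0 only strengthens this.
   Since N := Gamma_{m+n+1} K is normal, the k with [h, k] in N form a
   subgroup, and Xbar and Ybar together generate K. *)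

Section lower_central_series.
Local Set Implicit Arguments.
Local Unset Strict Implicit.
Local Open Scope group_scope.
Context {G : groupType}.
Implicit Types (S A B X Y H : set G) (a b k : G).

Lemma subgroup1 H : subgroup H -> H 1.
Proof. by case. Qed.

Lemma subgroupV H a : subgroup H -> H a -> H a^-1.
Proof. by move=> [H1 Hd] Ha; have := Hd _ _ H1 Ha; rewrite div1g. Qed.

Lemma subgroupM H a b : subgroup H -> H a -> H b -> H (a * b).
Proof.
move=> sH Ha Hb; have := sH.2 _ _ Ha (subgroupV sH Hb).
by rewrite invgK.
Qed.

Lemma subgroup_gen S : subgroup (gen S).
Proof.
split=> [|a b Sa Sb] H [sH SH]; first exact: subgroup1.
by apply: sH.2; [exact: Sa|exact: Sb].
Qed.

Lemma sub_gen S : S `<=` gen S.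
Proof. by move=> a Sa H [_]; apply. Qed.

Lemma gen_sub S H : subgroup H -> S `<=` H -> gen S `<=` H.
Proof. by move=> sH SH a; apply. Qed.

Lemma comm_subgroupS A A' B B' : A `<=` A' -> B `<=` B' ->
  comm_subgroup A B `<=` comm_subgroup A' B'.
Proof.
move=> AA' BB'; apply: gen_sub; first exact: subgroup_gen.
move=> _ [a Aa [b Bb <-]]; apply: sub_gen.
by exists a; [exact: AA'|exists b; [exact: BB'|]].
Qed.

Lemma comm_conj k a b :
  k * comm a b * k^-1 = comm (k * a * k^-1) (k * b * k^-1).
Proof. by rewrite /comm !invgM !invgK !mulgA !mulgVK. Qed.

(** Conjugation by [k] is an automorphism that maps each generating commutator to another one, so
    the preimage of [comm_subgroup A B] under it is a subgroup containing all generators. *)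
Lemma normal_comm_subgroup A B :
  (forall k a, A a -> A (k * a * k^-1)) ->
  (forall k b, B b -> B (k * b * k^-1)) ->
  normal_subgroup (comm_subgroup A B).
Proof.
move=> nA nB; split=> [|k a]; first exact: subgroup_gen.
have sAB := subgroup_gen [set comm a b | a in A & b in B].
suff: gen [set comm a b | a in A & b in B] `<=`
  [set a | comm_subgroup A B (k * a * k^-1)] by apply.
apply: gen_sub; last first.
  move=> _ [c Ac [b Bb <-]] /=; rewrite comm_conj; apply: sub_gen.
  by exists (k * c * k^-1); [exact: nA|exists (k * b * k^-1); [exact: nB|]].
split=> [|c b /= cA bB]; first by rewrite /= mulg1 mulgV; exact: subgroup1.
by have := sAB.2 _ _ cA bB; rewrite !invgM !invgK !mulgA mulgVK.
Qed.

(** [lcs] iterates [n.-1] times: indices 0 and 1 both give [X], and the recursion starts at 1. *)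
Lemma lcsS X n : (0 < n)%N -> lcs X n.+1 = comm_subgroup X (lcs X n).
Proof. by case: n. Qed.

Lemma normal_lcs n : normal_subgroup (lcs (@setT G) n).
Proof.
rewrite /lcs; elim: n.-1 => [|m [_ IH]]; first by do ![split].
exact: normal_comm_subgroup.
Qed.

Lemma subset_lcs X X' n : X `<=` X' -> lcs X n `<=` lcs X' n.
Proof.
move=> XX'; rewrite /lcs; elim: n.-1 => [|m IH] //=.
exact: comm_subgroupS.
Qed.

Lemma lcs_anti m n : (m <= n)%N -> lcs (@setT G) n `<=` lcs setT m.
Proof.
elim: n => [|n IH]; first by rewrite leqn0 => /eqP ->.
rewrite leq_eqVlt ltnS => /predU1P[->//|/IH]; apply: subset_trans.
case: n {IH} => // n; rewrite lcsS //.
have [sN nN] := normal_lcs n.+1; apply: gen_sub => //.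
(* [comm a b] is a conjugate of [b] divided by [b]. *)
by move=> _ [a _ [b Nb <-]]; apply: sN.2 => //; exact: nN.
Qed.

Lemma double_lcs_natSS X Y m n : double_lcs_nat X Y m.+1 n.+1 =
  set_mul (comm_subgroup X (double_lcs_nat X Y m n.+1))
          (comm_subgroup Y (double_lcs_nat X Y m.+1 n)).
Proof. by []. Qed.

(** Each factor of K_{m+1,n+1} is a bracket with a term of total index one lower, which matches one
    step of [lcs setT]. The corner K_{0,0} fits because [lcs setT 0] is [setT]. *)
Lemma double_lcs_nat_sub X Y m n :
  double_lcs_nat X Y m n `<=` lcs setT (m + n)%N.
Proof.
elim: m n => [[//|n]|m IHm]; first exact: subset_lcs.
elim=> [|n IHn]; first by rewrite addn0; exact: subset_lcs.
have [sN _] := normal_lcs (m.+1 + n.+1)%N.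
rewrite double_lcs_natSS => _ [a Xa [b Yb <-]]; apply: (subgroupM sN).
  rewrite addSn lcsS ?addnS //; apply: comm_subgroupS Xa => //.
  by rewrite -addnS; exact: IHm.
by rewrite addnS lcsS //; exact: comm_subgroupS Yb.
Qed.

Lemma double_lcs_sub X Y (m n : int) (k : nat) : k%:Z%R <= (m + n)%R ->
  double_lcs X Y m n `<=` lcs setT k.
Proof.
move=> kmn; apply: subset_trans (@double_lcs_nat_sub X Y _ _) _.
(* Truncating [m] and [n] at 0 can only increase their sum. *)
by apply: lcs_anti; lia.
Qed.

Lemma subgroup_word_val (I : Type) (b : I -> G) H w :
  subgroup H -> (forall i, H (b i)) -> H (word_val b w).
Proof.
move=> sH Hb; rewrite /word_val; elim/big_ind: _ => [|c d|l _].
- exact: subgroup1.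
- exact: subgroupM.
- by case: ifP => _; [|apply: subgroupV].
Qed.

Lemma free_basis_gen (I : eqType) (b : I -> G) H :
  free_basis b -> subgroup H -> (forall i, H (b i)) -> setT `<=` H.
Proof.
by move=> fb sH Hb k _; have [w [[_ <-] _]] := fb k; exact: subgroup_word_val.
Qed.

Lemma sub_normal_closure S : S `<=` normal_closure S.
Proof. by move=> a Sa H [_]; apply. Qed.

Section action.
Context {M : groupType} (act : M -> G -> G).
Hypothesis actM : forall h, {morph act h : k l / k * l}.

(** These are the elements on which two homomorphisms to G/N agree: the projection, and [act h]
    followed by the projection. *)
Lemma subgroup_act_comm (h : M) N : normal_subgroup N ->
  subgroup [set k | N (act_comm act h k)].
Proof.
move=> [sN nN]; have act1 : act h 1 = 1.
  by apply: (mulgI (act h 1)); rewrite -actM !mulg1.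
have actV b : act h b^-1 = (act h b)^-1.
  by apply: (mulgI (act h b)); rewrite -actM !mulgV.
split=> [|a b /= Na Nb]; first by rewrite /= /act_comm act1 mulgV; exact: sN.1.
(* The crossed homomorphism rule [h, kl] = [h, k] k [h, l] k^-1, adapted to a quotient. *)
have -> : act_comm act h (a / b) = act_comm act h a *
    ((a / b) * (act_comm act h b)^-1 * (a / b)^-1).
  by rewrite /act_comm actM actV !invgM !invgK !mulgA !mulgVK.
by apply: (subgroupM sN) => //; apply: nN; exact: subgroupV.
Qed.

(** The group-theoretic core: topology enters through the action by endomorphisms and the generation
    of the group by [X] and [Y]. *)
Lemma double_johnson_sub X Y (m n : int) (k : nat) :
  (forall H, subgroup H -> X `<=` H -> Y `<=` H -> setT `<=` H) ->
  k%:Z%R <= (m + n)%R -> double_johnson act X Y m n `<=` johnson act k.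
Proof.
move=> XYgen kmn h /(_ h (or_introl erefl))[hX hY].
apply: (XYgen [set s | lcs setT k.+1 (act_comm act h s)]) => [|s Xs|s Ys].
- by apply: subgroup_act_comm; exact: normal_lcs.
(* [double_lcs X Y 1 0] computes to [X], and likewise [double_lcs X Y 0 1] to [Y]; both target
   bidegrees have total m + n + 1. *)
- by apply: (@double_lcs_sub X Y (m + 1)%R n); [lia|exact: hX].
- by apply: (@double_lcs_sub X Y m (n + 1)%R); [lia|exact: hY].
Qed.

End action.
End lower_central_series.

(* [K] is [pi1 R p] and [M] is [mcg (surface_boundary g e) O]; [Xbar] and [Ybar]
   are the kernels of K -> pi_1(V) and K -> pi_1(V'). *)
Theorem proposition4p27 (R : realType) (g : nat)
  (e : R * R -> S3 R) (e_disk : embedded_disk (heegaard_surface g) e)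
  (O : set (R * R -> surface g e)) (O_or : orientation (surface_boundary g e) O)
  (p : surface g e) (bp : surface_boundary g e p)
  (x y : 'I_g -> pi1 R p)
  (Xbar := inclusion_kernel R (surface_sub g e) p)
  (Ybar := inclusion_kernel R (surface_sub' g e) p)
  (xy_basis : free_basis
     (fun i : 'I_g + 'I_g => match i with inl j => x j | inr j => y j end))
  (Xbar_x : Xbar = normal_closure (range x))
  (Ybar_y : Ybar = normal_closure (range y))
  (m n : int) (m_ge : -1 <= m) (n_ge : -1 <= n) (mn_ge : 1 <= m + n) :
  double_johnson (mcg_act (O := O) bp) Xbar Ybar m n
    `<=` johnson (mcg_act (O := O) bp) `|(m + n)%R|%N.
Proof.
(* As m + n is positive, the absolute value in the Johnson index leaves it unchanged. *)
apply: double_johnson_sub => [||]; [exact: mcg_act_morph| |lia].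
move=> H sH; rewrite Xbar_x Ybar_y => XH YH.
(* Meridians lie in [Xbar] and parallels in [Ybar], so [H] contains the whole free basis. *)
apply: (free_basis_gen xy_basis sH) => -[j|j].
  by apply: XH; apply: sub_normal_closure; exists j.
by apply: YH; apply: sub_normal_closure; exists j.
Qed.
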